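(* For every integer $d\ge 1$, every integer $k\geq 1$ and every real number $B$, the set of points $x\in\mathbf P^k(\overline{\mathbf Q})$ which are defined over a number field of degree at most $d$ over $\mathbf Q$ and satisfy $h(x)\le B$ is finite.
   Context: $h$ denotes the absolute logarithmic Weil height on projective space over $\overline{\mathbf Q}$: if $x=[x_0:\cdots:x_k]$ with coordinates in a number field $K$, then $$h(x)=\frac1{[K:\mathbf Q]}\sum_{p\le\infty}\ \sum_{\sigma\colon K\hookrightarrow\mathbf C_p}\log\max(|\sigma(x_0)|_p,\dots,|\sigma(x_k)|_p),$$ where $p$ runs over the prime numbers and the symbol $\infty$, $\mathbf C_\infty=\mathbf C$, and $\mathbf C_p$ (for $p$ prime) is the completion of an algebraic closure of $\mathbf Q_p$, with its absolute value extending the standard $p$-adic one ($|p|_p=1/p$). A point $x$ is defined over a number field $K$ if it admits a system of homogeneous coordinates in $K$. *)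

(* Defs.v *)
From HB Require Import structures.
From mathcomp Require Import all_boot all_order all_algebra all_field.
From mathcomp Require Import generic_quotient.
From mathcomp Require Import all_classical all_reals all_analysis.
From mathcomp.real_closed Require Import complex.

Set Implicit Arguments.
Unset Strict Implicit.
Unset Printing Implicit Defensive.

Import Order.TTheory GRing.Theory Num.Theory.
Local Open Scope classical_set_scope.
Local Open Scope quotient_scope.
Local Open Scope ring_scope.

(* Points of P^k over Qbar, with Qbar := algC: nonzero vectors up to scaling. *)

Definition nonzero_vector (k : nat) : Type :=
  {v : 'rV[algC]_k.+1 | v != 0}.
HB.instance Definition _ k := Choice.on (nonzero_vector k).

Definition proportional (k : nat) : rel (nonzero_vector k) :=
  fun v w => `[< exists2 c : algC, c != 0 & val w = c *: val v >].

Lemma proportional_refl k : reflexive (@proportional k).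
Proof. by move=> v; apply/asboolP; exists 1; rewrite ?oner_neq0 ?scale1r. Qed.

Lemma proportional_sym k : symmetric (@proportional k).
Proof.
have half (v w : nonzero_vector k) : proportional v w -> proportional w v.
  move=> /asboolP[c c0 wE]; apply/asboolP; exists c^-1; first by rewrite invr_eq0.
  by rewrite wE scalerA mulVf // scale1r.
by move=> v w; apply/idP/idP; apply: half.
Qed.

Lemma proportional_trans k : transitive (@proportional k).
Proof.
move=> v u w /asboolP[b b0 vE] /asboolP[c c0 wE]; apply/asboolP.
by exists (c * b); rewrite ?mulf_neq0 // wE vE scalerA.
Qed.

Canonical proportional_equiv k :=
  EquivRel (@proportional k) (@proportional_refl k) (@proportional_sym k)
    (@proportional_trans k).

Definition proj_space (k : nat) := {eq_quot (@proportional_equiv k)}.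

HB.instance Definition _ k := EqQuotient.on (proj_space k).

Definition homogeneous_coords k (x : proj_space k) (v : 'rV[algC]_k.+1) : Prop :=
  exists v_neq0 : v != 0,
    x = \pi_(proj_space k) (exist _ v v_neq0 : nonzero_vector k).

(* A number field is a finite extension of rat; it is placed in Qbar by an
   arbitrary embedding. *)
Definition coords_in k (x : proj_space k) (K : fieldExtType rat)
    (iota : {rmorphism K -> algC}) (y : 'rV[K]_k.+1) : Prop :=
  homogeneous_coords x (map_mx iota y).

Definition defined_over_degree_le k (d : nat) (x : proj_space k) : Prop :=
  exists (K : fieldExtType rat) (iota : {rmorphism K -> algC}),
    (\dim {:K} <= d)%N /\ exists y : 'rV[K]_k.+1, coords_in x iota y.

(* |q|_p on rat; numq q = 0 has to be treated apart since logn p 0 = 0. *)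
Definition padic_abs (R : realType) (p : nat) (q : rat) : R :=
  if q == 0 then 0
  else p%:R ^+ logn p `|denq q|%N / p%:R ^+ logn p `|numq q|%N.

Definition nonarch_abs (R : realType) (F : fieldType) (v : F -> R) : Prop :=
  [/\ forall x, 0 <= v x,
      forall x, v x = 0 <-> x = 0,
      forall x y, v (x * y) = v x * v y
    & forall x y, v (x + y) <= Num.max (v x) (v y)].

Definition abs_cauchy (R : realType) (F : fieldType) (v : F -> R)
    (u : nat -> F) : Prop :=
  forall e : R, 0 < e ->
    exists N : nat, forall m n, (N <= m)%N -> (N <= n)%N -> v (u m - u n) < e.

Definition abs_converges (R : realType) (F : fieldType) (v : F -> R)
    (u : nat -> F) (l : F) : Prop :=
  forall e : R, 0 < e ->
    exists N : nat, forall n, (N <= n)%N -> v (u n - l) < e.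

Definition abs_complete (R : realType) (F : fieldType) (v : F -> R) : Prop :=
  forall u, abs_cauchy v u -> exists l, abs_converges v u l.

Definition is_completion (R : realType) (F L : fieldType)
    (vF : F -> R) (vL : L -> R) (j : {rmorphism F -> L}) : Prop :=
  [/\ forall x, vL (j x) = vF x,
      forall (z : L) (e : R), 0 < e -> exists x : F, vL (z - j x) < e
    & abs_complete vL].

(* The tower Q -> Q_p -> Qbar_p -> C_p with its absolute values.  The libraries
   construct none of the last three fields; this data determines them up to
   isometric isomorphism, so a statement is made for every such tower. *)
Record padic_tower (R : realType) (p : nat) := PadicTower {
  Qp : fieldType;
  Qp_abs : Qp -> R;
  Qp_of_rat : {rmorphism rat -> Qp};
  Qp_abs_nonarch : nonarch_abs Qp_abs;
  Qp_completion : is_completion (padic_abs R p) Qp_abs Qp_of_rat;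

  Qpbar : closedFieldType;
  Qpbar_abs : Qpbar -> R;
  Qpbar_of_Qp : {rmorphism Qp -> Qpbar};
  Qpbar_algebraic : forall z : Qpbar, algebraicOver Qpbar_of_Qp z;
  Qpbar_abs_nonarch : nonarch_abs Qpbar_abs;
  Qpbar_abs_ext : forall z, Qpbar_abs (Qpbar_of_Qp z) = Qp_abs z;

  Cp : fieldType;
  Cp_abs : Cp -> R;
  Cp_of_Qpbar : {rmorphism Qpbar -> Cp};
  Cp_abs_nonarch : nonarch_abs Cp_abs;
  Cp_completion : is_completion Qpbar_abs Cp_abs Cp_of_Qpbar
}.

Definition prime_number : Type := {p : nat | prime p}.
HB.instance Definition _ := Choice.on prime_number.

Definition embeddings (K L : fieldType) : set (K -> L) :=
  [set s : K -> L | exists f : {rmorphism K -> L}, s = f].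

Definition log_max (R : realType) (L : fieldType) (v : L -> R) n
    (z : 'rV[L]_n) : R :=
  ln (\big[Num.max/0]_(i < n) v (z 0 i)).

Definition local_height (R : realType) (K L : fieldType) (v : L -> R) n
    (y : 'rV[K]_n) : R :=
  \sum_(s \in @embeddings K L) log_max v (map_mx s y).

(* Both sums have finite support when y != 0: there are [K : Q] embeddings into
   each C_p, and the term at p vanishes for almost all p. *)
Definition height_coords (R : realType)
    (C : forall p : prime_number, padic_tower R (val p))
    (K : fieldExtType rat) n (y : 'rV[K]_n) : R :=
  (\dim {:K})%:R^-1 *
  (local_height (@ComplexField.Normc.normc R : R[i] -> R) y +
   \sum_(p \in [set: prime_number]) local_height (@Cp_abs _ _ (C p)) y).

(* height_coords depends neither on the number field nor on the coordinates,
   so the set below is a singleton and xget returns its element. *)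
Definition weil_height (R : realType)
    (C : forall p : prime_number, padic_tower R (val p)) k
    (x : proj_space k) : R :=
  xget 0 [set r : R | exists (K : fieldExtType rat)
      (iota : {rmorphism K -> algC}) (y : 'rV[K]_k.+1),
    coords_in x iota y /\ r = height_coords C y].

(* Main.v *)
Require Import Defs.
From HB Require Import structures.
From mathcomp Require Import all_boot all_order all_algebra all_field.
From mathcomp Require Import all_classical all_reals all_analysis.
From mathcomp.real_closed Require Import complex.
From mathcomp Require Import zify ring lra.

Import Order.TTheory GRing.Theory Num.Theory.
Local Open Scope classical_set_scope.
Local Open Scope ring_scope.

Set Implicit Arguments.
Unset Strict Implicit.
Unset Printing Implicit Defensive.

(** Let y be homogeneous coordinates of x in a number field K of any degree D,
    with y_j <> 0, and let m be the primitive integral minimal polynomial of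
    a = y_i / y_j, of degree e.  The norm form prod_s (s(y_j) X - s(y_i)), s
    ranging over the embeddings of K, is a rational polynomial which does not
    depend on the target field, and equals c m^n with c rational and n e = D.
    At a prime p its Gauss norm |c|_p is at most prod_s max_l |s(y_l)|_p; at
    infinity its Mahler measure |c| M(m)^n is at most prod_s max_l |s(y_l)|.
    The product formula for c gives n log M(m) <= D h(x), that is,
    log M(m) <= e h(x).  If x is also defined over a field of degree at most d
    then e <= d, so m lies in a finite set, and so do all ratios y_i / y_j. *)

(** * Morphisms out of Q, primitive elements and splitting of rational polynomials *)

Lemma eq_rmorphism_rat (L : nzRingType) (f g : {rmorphism rat -> L}) : f =1 g.
Proof.
move=> q; have denq_unit (h : {rmorphism rat -> L}) :
    h q * (denq q)%:~R = (numq q)%:~R.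
  by rewrite -(rmorph_int h) -rmorphM -numqE rmorph_int.
have inv_den (h : {rmorphism rat -> L}) : (denq q)%:~R * h (denq q)%:~R^-1 = 1.
  by rewrite -(rmorph_int h) -rmorphM divff ?rmorph1 // intr_eq0 denq_eq0.
rewrite -[f q]mulr1 -[g q]mulr1 -(inv_den f) !mulrA.
by rewrite !denq_unit.
Qed.

Lemma eq_map_poly_rat (L : nzRingType) (f g : {rmorphism rat -> L})
  (q : {poly rat}) : map_poly f q = map_poly g q.
Proof. by apply: eq_map_poly; apply: eq_rmorphism_rat. Qed.

(** Characteristic 0 makes K separable over Q, hence generated by one element [t]; the minimal
    polynomial of [t] descends to the rational polynomial [P]. *)
Lemma primitive_element_rat (K : fieldExtType rat) :
  exists (t : K) (P : {poly rat}),
    [/\ P \is monic /\ size P = (\dim {:K}).+1,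
        root (map_poly (in_alg K) P) t,
        forall q, root (map_poly (in_alg K) q) t -> P %| q,
        separable_poly P
      & forall z : K, exists g, z = (map_poly (in_alg K) g).[t]].
Proof.
have pch : [pchar K] =i pred0 by move=> p; rewrite (pchar_lalg K) pchar_num.
have sepK : separable 1 {:K}.
  by apply/separableP => y _; apply: pcharf0_separable.
have := eq_adjoin_separable_generator sepK (sub1v _).
set t := separable_generator _ _ => Kt.
have /polyOver1P[P PE] := minPolyOver 1 t.
have rootP : root (map_poly (in_alg K) P) t by rewrite -PE root_minPoly.
exists t, P; split => //.
- split; first by rewrite -(map_monic (in_alg K)) -PE monic_minPoly.
  by rewrite -(size_map_poly (in_alg K)) -PE size_minPoly adjoin_degreeE -Kt
    dimv1 divn1.
- move=> q rq; rewrite -(dvdp_map (in_alg K)) -PE minPoly_dvdp //.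
  by apply/polyOver1P; exists q.
- rewrite -(separable_map (in_alg K)) -PE.
  exact: (pcharf0_separable 1%AS pch).
- by move=> z; apply/Fadjoin1_polyP; rewrite -Kt memvf.
Qed.

(** [padic_tower] gives [Cp] as a plain field. Splitting of rational polynomials passes up to it
    from [Qpbar] and is enough to find all embeddings of a number field. *)
Definition rat_splits (L : fieldType) (f : {rmorphism rat -> L}) : Prop :=
  forall q : {poly rat}, exists rs : seq L,
    map_poly f q = f (lead_coef q) *: \prod_(r <- rs) ('X - r%:P).

Lemma closed_field_rat_splits (L : closedFieldType) (f : {rmorphism rat -> L}) :
  rat_splits f.
Proof.
move=> q; have [rs ->] := closed_field_poly_normal (map_poly f q).
by exists rs; rewrite lead_coef_map.
Qed.

Lemma rat_splits_comp (L L' : fieldType) (f : {rmorphism rat -> L})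
  (g : {rmorphism L -> L'}) (h : {rmorphism rat -> L'}) :
  rat_splits f -> rat_splits h.
Proof.
move=> fs q; have [rs qE] := fs q; exists [seq g r | r <- rs].
rewrite (eq_map_poly_rat h (g \o f)) map_poly_comp qE map_polyZ rmorph_prod.
rewrite big_map (eq_rmorphism_rat h (g \o f)) /=; congr (_ *: _).
by apply: eq_bigr => r _; rewrite rmorphB /= map_polyX map_polyC.
Qed.

(** * Embeddings of a number field and roots of a minimal polynomial *)

Section Embeddings.
Variables (K : fieldExtType rat) (t : K) (P : {poly rat}).
Hypotheses (Pmonic : P \is monic) (Psize : size P = (\dim {:K}).+1).
Hypothesis Pt : root (map_poly (in_alg K) P) t.
Hypothesis Pmin : forall q, root (map_poly (in_alg K) q) t -> P %| q.
Hypothesis Psep : separable_poly P.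
Hypothesis tgen : forall z : K, exists g, z = (map_poly (in_alg K) g).[t].
Variables (L : fieldType) (f : {rmorphism rat -> L}).

Lemma rmorphism_horner (s : {rmorphism K -> L}) (g : {poly rat}) :
  s (map_poly (in_alg K) g).[t] = (map_poly f g).[s t].
Proof.
rewrite -horner_map /= -map_poly_comp; congr horner.
by apply: (eq_map_poly_rat (s \o in_alg K) f).
Qed.

(** The embedding sends g(t) to g(r). This does not depend on g: two choices differ by a multiple of
    [P], which vanishes at [r]. *)
Lemma embedding_of_root (r : L) : root (map_poly f P) r ->
  exists2 s : {rmorphism K -> L}, s t = r
    & forall g, s (map_poly (in_alg K) g).[t] = (map_poly f g).[r].
Proof.
move=> Pr; pose G z := projT1 (cid (tgen z)).
have GE z : (map_poly (in_alg K) (G z)).[t] = z.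
  by rewrite /G; case: cid => /= g ->.
pose s z := (map_poly f (G z)).[r].
have sE g : s (map_poly (in_alg K) g).[t] = (map_poly f g).[r].
  rewrite /s; apply/eqP; rewrite -subr_eq0 -hornerN -hornerD -rmorphN
    -rmorphD /=.
  rewrite -rootE -dvdp_XsubCl; move: Pr; rewrite -dvdp_XsubCl => /dvdp_trans;
    apply.
  rewrite dvdp_map; apply: Pmin.
  by rewrite rootE rmorphB hornerD hornerN /= GE subrr.
have sB : zmod_morphism s.
  move=> z w; rewrite -{1}[z]GE -{1}[w]GE -hornerN -hornerD -rmorphN -rmorphD
    /=.
  by rewrite sE rmorphB hornerD hornerN.
have sM : monoid_morphism s.
  split=> [|z w].
    by have := sE 1; rewrite !rmorph1 !hornerC.
  by rewrite -{1}[z]GE -{1}[w]GE -hornerM -rmorphM /= sE rmorphM hornerM.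
pose sA := GRing.isZmodMorphism.Build K L s sB.
pose sMm := GRing.isMonoidMorphism.Build K L s sM.
pose S : {rmorphism K -> L} := HB.pack s sA sMm.
exists S; last exact: sE.
have := sE 'X; rewrite !map_polyX !hornerX.
by [].
Qed.

(** An embedding is determined by the image of [t], which can be any root of [P]; separability makes
    these roots distinct, so there are [K:Q] of them. *)
Lemma embeddings_roots : rat_splits f ->
  exists rs : seq L, exists sg : L -> K -> L,
  [/\ uniq rs, size rs = \dim {:K},
      forall r g, r \in rs -> sg r (map_poly (in_alg K) g).[t] = (map_poly f
        g).[r],
      forall r, r \in rs -> root (map_poly f P) r
    & uniq [seq sg r | r <- rs] /\
      @embeddings K L = [set` [seq sg r | r <- rs]]].
Proof.
move=> /(_ P)[rs]; rewrite (monicP Pmonic) rmorph1 scale1r => PE.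
have urs : uniq rs.
  by rewrite -separable_prod_XsubC -PE separable_map.
have srs : size rs = \dim {:K}.
  by apply: succn_inj; rewrite -(size_prod_XsubC rs id) -PE size_map_poly.
have rrs r : r \in rs -> root (map_poly f P) r by rewrite PE root_prod_XsubC.
have [sg sgE] : exists sg : L -> K -> L, forall r, r \in rs ->
    exists2 s : {rmorphism K -> L}, sg r = s & s t = r.
  have : forall r : L, exists s : K -> L, r \in rs ->
      exists2 s' : {rmorphism K -> L}, s = s' & s' t = r.
    (* Off [rs] the zero map serves as a default value. *)
    move=> r; have [rr|_] := boolP (r \in rs); last by exists (fun=> 0).
    by have [s st _] := embedding_of_root (rrs r rr); exists s => _; exists s.
  by move=> /choice[sg sgE]; exists sg => r; apply: sgE.
exists rs, sg; split => //.
- move=> r g rr; have [s -> st] := sgE r rr.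
  by rewrite rmorphism_horner st.
- split.
    rewrite map_inj_in_uniq // => r1 r2 /sgE[s1 -> s1t] /sgE[s2 -> s2t] s12.
    by rewrite -s1t -s2t s12.
  apply/seteqP; split => [_ [s ->]|s] /=.
    have st : s t \in rs.
      rewrite -root_prod_XsubC -PE rootE -rmorphism_horner.
      by rewrite (eqP Pt) rmorph0.
    apply/mapP; exists (s t) => //; apply/funext => z.
    have [s' -> s't] := sgE _ st; have [g ->] := tgen z.
    by rewrite !rmorphism_horner s't.
  by move=> /mapP[r rr ->]; have [s' -> _] := sgE r rr; exists s'.
Qed.

End Embeddings.

(** * The norm from K to Q of the linear form u X - w *)

Definition embeddings_norm_form (K : fieldExtType rat) (u w : K)
    (F : {poly rat}) : Prop :=
  forall (L : fieldType) (f : {rmorphism rat -> L}) (ss : seq (K -> L)),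
    uniq ss -> @embeddings K L = [set` ss] -> rat_splits f ->
    map_poly f F = \prod_(s <- ss) (s u *: 'X - (s w)%:P).

(* F is the determinant of the matrix of multiplication by u X - w in the power
   basis of K; a Vandermonde matrix diagonalises it over L. *)
Lemma embeddings_norm_formP (K : fieldExtType rat) (u w : K) :
  exists F, embeddings_norm_form u w F.
Proof.
have [t [P [[Pmonic Psize] Pt Pmin Psep tgen]]] := primitive_element_rat K.
set n := \dim {:K} in Psize.
have [gu uE] := tgen u; have [gw wE] := tgen w.
(* Row i holds the coordinates of t^i g(t) in the basis 1, t, ..., t^(n-1). *)
pose M (g : {poly rat}) (i j : 'I_n) : rat := (('X^i * g) %% P)`_j.
exists (\det (\matrix_(i < n, j < n) (M gu i j *: 'X - (M gw i j)%:P))).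
move=> L f ss uss ssE Lsplit.
have [rs [sg [urs srs sgE rrs [usg sgss]]]] :=
  embeddings_roots Pmonic Psize Pt Pmin Psep tgen Lsplit.
have pss : perm_eq ss [seq sg r | r <- rs].
  apply: uniq_perm => // s.
  have := congr1 (fun A : set (K -> L) => A s) (etrans (esym ssE) sgss).
  by move=> /= sE; apply/idP/idP; rewrite sE.
rewrite (perm_big _ pss) big_map -det_map_mx /=.
pose r (j : 'I_n) : L := rs`_j.
have rP j : r j \in rs by rewrite mem_nth // srs.
pose V := map_mx (@polyC L) (Vandermonde n (\row_j r j)).
have VN0 : \det V != 0.
  rewrite det_map_mx polyC_eq0 det_Vandermonde.
  apply/prodf_neq0 => i _; apply/prodf_neq0 => j ij.
  by rewrite !mxE subr_eq0 nth_uniq ?srs // gtn_eqF.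
(* The column (1, r_k, ..., r_k^(n-1)) is an eigenvector of [M g] with eigenvalue g(r_k), because
   reduction modulo [P] keeps values at the root r_k. *)
have ME g (i k : 'I_n) :
    \sum_(j < n) f (M g i j) * r k ^+ j = r k ^+ i * (map_poly f g).[r k].
  have szM : (size (map_poly f (('X^i * g) %% P)) <= n)%N.
    by rewrite size_map_poly -ltnS -Psize ltn_modp monic_neq0.
  transitivity (map_poly f (('X^i * g) %% P)).[r k].
    by rewrite (horner_coef_wide _ szM); apply: eq_bigr => j _; rewrite
      coef_map.
  have -> : r k ^+ i * (map_poly f g).[r k] = (map_poly f ('X^i * g)).[r k].
    by rewrite rmorphM /= map_polyXn hornerM hornerXn.
  rewrite [in RHS](divp_eq ('X^i * g) P) rmorphD rmorphM hornerD hornerM /=.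
  by have /rootP-> := rrs _ (rP k); rewrite mulr0 add0r.
apply: (mulIf VN0).
transitivity (\det (V *m diag_mx (\row_j (sg (r j) u *: 'X - (sg (r j)
  w)%:P)))).
  rewrite -det_mulmx; congr (\det _); apply/matrixP => i k.
  rewrite mul_mx_diag !mxE.
  transitivity (\sum_(j < n) ((f (M gu i j) * r k ^+ j)%:P * 'X
      - (f (M gw i j) * r k ^+ j)%:P)).
    apply: eq_bigr => j _; rewrite !mxE rmorphB /= map_polyZ map_polyX
      map_polyC /=.
    by rewrite -mul_polyC !polyCM mulrBl; congr (_ - _); rewrite mulrAC.
  rewrite sumrB -mulr_suml -!rmorph_sum !ME /= uE wE !sgE //.
  by rewrite -mul_polyC !polyCM mulrBr mulrA.
rewrite det_mulmx mulrC det_diag; congr (_ * _).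
rewrite (big_nth 0) srs big_mkord; apply: eq_bigr => j _.
by rewrite mxE.
Qed.

Lemma embeddings_enum (K : fieldExtType rat) (L : fieldType)
    (f : {rmorphism rat -> L}) : rat_splits f ->
  exists ss : seq (K -> L),
    [/\ uniq ss, @embeddings K L = [set` ss] & size ss = \dim {:K}].
Proof.
have [t [P [[Pmonic Psize] Pt Pmin Psep tgen]]] := primitive_element_rat K.
move=> /(embeddings_roots Pmonic Psize Pt Pmin Psep tgen).
by move=> [rs [sg [_ srs _ _ [usg sgE]]]]; exists [seq sg r | r <- rs];
  rewrite size_map.
Qed.

(** * Minimal polynomials over Q and the norm form as one of their powers *)

Definition min_poly_rat (a : algC) (m : {poly rat}) : Prop :=
  m \is monic /\ forall q, root (map_poly ratr q) a = (m %| q).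

Lemma min_poly_rat_size a m : min_poly_rat a m -> (1 < size m)%N.
Proof.
move=> [mm mE]; rewrite ltnNge; apply/negP => /size1_polyC m0.
have := mE m; rewrite dvdpp m0 map_polyC rootC /= fmorph_eq0.
by move: (monic_neq0 mm); rewrite {1}m0 polyC_eq0 => /negPf ->.
Qed.

(** Minimality makes [m] irreducible over Q. A nonconstant [q] shares a root with [m], so [m]
    divides it; the quotient satisfies the same hypotheses, and induction on the size applies. *)
Lemma min_poly_rat_power (a : algC) (m q : {poly rat}) (L : closedFieldType)
    (f : {rmorphism rat -> L}) : min_poly_rat a m -> q \is monic ->
  (forall r, root (map_poly f q) r -> root (map_poly f m) r) ->
  exists n, q = m ^+ n.
Proof.
move=> mP; have [mm mE] := mP; have m1 := min_poly_rat_size mP.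
have [d] := ubnP (size q); elim: d q => // d IH q szq mq rq.
have [sz1|sz1] := leqP (size q) 1.
  exists 0%N; move: mq; rewrite (size1_polyC sz1) expr0 monicE lead_coefC.
  by move=> /eqP->.
have [r qr] : exists r, root (map_poly f q) r.
  by apply/closed_rootP; rewrite size_map_poly; case: (size q) sz1 => [|[]].
(* As m is minimal, a nonconstant common factor of m and q is m itself. *)
have g1 : (size (gcdp m q) != 1)%N.
  apply/negP; rewrite -/(coprimep m q) -(coprimep_map f) => /coprimep_root.
  by move=> /(_ r (rq _ qr)); move: qr; rewrite rootE => ->.
have mg : m %| gcdp m q.
  have gm := dvdp_gcdl m q; have mEq := divpK gm.
  set h := m %/ gcdp m q in mEq.
  have : root (map_poly ratr m) a by rewrite mE.
  rewrite -[X in map_poly _ X]mEq rmorphM rootM /= !mE => /orP[mh|//].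
  have h0 : h != 0 by apply: contraNneq (monic_neq0 mm) => h0; rewrite -mEq
    h0 mul0r.
  have g0 : gcdp m q != 0.
    by apply: contraNneq (monic_neq0 mm) => h1; rewrite -mEq h1 mulr0.
  have szE : size m = size (h * gcdp m q) by rewrite mEq.
  have := dvdp_leq h0 mh; rewrite szE size_mul //.
  move: g1 g0; rewrite -size_poly_gt0; case: (size (gcdp m q)) => [|[|b]] //
    _ _.
  by rewrite !addnS /= -ltn_subRL subnn.
have mq' : m %| q by apply: dvdp_trans mg (dvdp_gcdr m q).
have qE := divpK mq'; set h := q %/ m in qE.
have mh : h \is monic by rewrite -(monicMr _ mm) qE.
have [n hE] : exists n, h = m ^+ n.
  apply: IH => // [|s hs]; last first.
    by apply: rq; rewrite -qE rmorphM rootM hs.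
  have := szq; rewrite -qE size_mul ?monic_neq0 //.
  case: (size m) m1 => [|[|b]] // _; rewrite !addnS /= ltnS.
  by move=> /(leq_ltn_trans _); apply; apply: leq_addr.
by exists n.+1; rewrite -qE hE exprSr.
Qed.

Lemma root_map_rat (K : fieldExtType rat) (L : fieldType)
    (g : {rmorphism K -> L}) (f : {rmorphism rat -> L}) (q : {poly rat}) (z :
      K) :
  root (map_poly f q) (g z) = root (map_poly (in_alg K) q) z.
Proof.
by rewrite (eq_map_poly_rat f (g \o in_alg K)) map_poly_comp fmorph_root.
Qed.

(** Up to its leading coefficient, [F] is the product of the X - s(w/u) over the embeddings s. Each
    s(w/u) is a root of [m], so the product is a power of [m]; the exponent is read off from the
    degrees. *)
Lemma norm_form_power (K : fieldExtType rat) (iota : {rmorphism K -> algC})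
    (u w : K) F m : u != 0 -> min_poly_rat (iota (w / u)) m ->
  embeddings_norm_form u w F ->
  exists n, [/\ lead_coef F != 0, F = lead_coef F *: m ^+ n
    & ((size m).-1 * n = \dim {:K})%N].
Proof.
move=> u0 mP FP; have [mm mE] := mP.
pose f : {rmorphism rat -> algC} := ratr.
have fs : rat_splits f by apply: closed_field_rat_splits.
have [ss [uss ssE sss]] := embeddings_enum K fs.
have ssR s : s \in ss -> exists g : {rmorphism K -> algC}, s = g.
  by move=> sss'; have : @embeddings K algC s by rewrite ssE.
have FE : map_poly f F = (\prod_(s <- ss) s u) *:
    \prod_(s <- ss) ('X - (s (w / u))%:P).
  rewrite (FP _ f ss uss ssE fs) -mul_polyC rmorph_prod -big_split /=.
  rewrite big_seq [in RHS]big_seq; apply: eq_bigr => s /ssR[g ->].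
  by rewrite -mul_polyC mulrBr -polyCM -rmorphM (mulrC u) divfK.
have N0 : \prod_(s <- ss) s u != 0.
  by rewrite prodf_seq_neq0; apply/allP => s /ssR[g ->] /=; rewrite fmorph_eq0.
have lF : f (lead_coef F) = \prod_(s <- ss) s u.
  rewrite -lead_coef_map FE lead_coefZ (monicP _) ?mulr1 //.
  exact: monic_prod_XsubC.
have F0 : lead_coef F != 0 by rewrite -(fmorph_eq0 f) lF.
pose q := (lead_coef F)^-1 *: F.
have qm : q \is monic by rewrite monicE lead_coefZ mulVf.
have qE : map_poly f q = \prod_(s <- ss) ('X - (s (w / u))%:P).
  by rewrite map_polyZ FE fmorphV lF scalerA mulVf // scale1r.
have [n qmn] : exists n, q = m ^+ n.
  apply: (min_poly_rat_power (f := f) mP qm) => r.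
  rewrite qE -(big_map (fun s => s (w / u)) xpredT (fun z => 'X - z%:P)).
  rewrite root_prod_XsubC => /mapP[s /ssR[g ->] ->].
  rewrite (root_map_rat g) -(root_map_rat iota ratr).
  by rewrite mE.
exists n; split => //; first by rewrite -qmn scalerA divff // scale1r.
apply: succn_inj; rewrite -sss -(size_prod_XsubC ss (fun s => s (w / u))) -qE.
by rewrite size_map_poly qmn -size_exp prednK // size_poly_gt0 expf_neq0
  ?monic_neq0.
Qed.

(** * Nonarchimedean absolute values *)

Section Nonarchimedean.
Variables (R : realType) (L : fieldType) (v : L -> R).
Hypothesis vna : nonarch_abs v.

Lemma nonarch_ge0 x : 0 <= v x. Proof. by case: vna. Qed.
Lemma nonarch_eq0 x : (v x == 0) = (x == 0).
Proof. by case: vna => _ H _ _; apply/eqP/eqP => /H. Qed.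
Lemma nonarchM x y : v (x * y) = v x * v y. Proof. by case: vna. Qed.
Lemma nonarchD x y : v (x + y) <= Num.max (v x) (v y). Proof. by case: vna. Qed.
Lemma nonarch0 : v 0 = 0. Proof. by apply/eqP; rewrite nonarch_eq0. Qed.

Lemma nonarch1 : v 1 = 1.
Proof.
have v1 : v 1 != 0 by rewrite nonarch_eq0 oner_eq0.
by apply: (mulfI v1); rewrite -nonarchM !mulr1.
Qed.

Lemma nonarchN x : v (- x) = v x.
Proof.
rewrite -mulN1r nonarchM; suff -> : v (-1) = 1 by rewrite mul1r.
apply/eqP; rewrite -(@pexpr_eq1 _ _ 2) ?nonarch_ge0 //.
by rewrite expr2 -nonarchM mulrNN mulr1 nonarch1.
Qed.

Lemma nonarchB x y : v (x - y) <= Num.max (v x) (v y).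
Proof. by rewrite -(nonarchN y) nonarchD. Qed.

Lemma nonarchX x n : v (x ^+ n) = v x ^+ n.
Proof.
by elim: n => [|n IH]; rewrite ?expr0 ?nonarch1 // !exprS nonarchM IH.
Qed.

Lemma nonarchV x : v x^-1 = (v x)^-1.
Proof.
have [->|x0] := eqVneq x 0; first by rewrite invr0 nonarch0 invr0.
have vx0 : v x != 0 by rewrite nonarch_eq0.
by apply: (mulfI vx0); rewrite -nonarchM !divff // nonarch1.
Qed.

Lemma nonarch_sum (I : eqType) (r : seq I) (F : I -> L) (M : R) : 0 <= M ->
  (forall i, i \in r -> v (F i) <= M) -> v (\sum_(i <- r) F i) <= M.
Proof.
move=> M0 FM; rewrite big_seq; elim/big_ind: _ => //; first by rewrite nonarch0.
move=> x y xM yM; apply: le_trans (nonarchD _ _) _.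
by rewrite ge_max xM yM.
Qed.

(** The easy half of Gauss's lemma: by the ultrametric inequality a linear factor a X - b multiplies
    the largest coefficient by at most max(|a|, |b|). *)
Lemma nonarch_coef_prod_linear (I : Type) (r : seq I) (a b : I -> L) i :
  v (\prod_(s <- r) (a s *: 'X - (b s)%:P))`_i
    <= \prod_(s <- r) Num.max (v (a s)) (v (b s)).
Proof.
elim: r i => [|s r IH] i.
  rewrite !big_nil coef1; case: eqP => _ /=; rewrite ?nonarch1 //.
  by rewrite nonarch0.
have P0 : 0 <= \prod_(j <- r) Num.max (v (a j)) (v (b j)).
  by apply: prodr_ge0 => j _; rewrite le_max nonarch_ge0.
rewrite !big_cons mulrBl -scalerAl coefB coefZ coefXM coefCM.
apply: le_trans (nonarchB _ _) _; rewrite ge_max !nonarchM.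
apply/andP; split; apply: ler_pM; rewrite ?nonarch_ge0 ?le_max ?lexx ?orbT //.
by case: (i == 0)%N => //; rewrite nonarch0.
Qed.

(** If |x| > 1, the leading term is strictly larger than all the others and cannot be cancelled by
    them. *)
Lemma nonarch_root_le1 (q : {poly L}) x : root q x -> v (lead_coef q) = 1 ->
  (forall i, v q`_i <= 1) -> v x <= 1.
Proof.
move=> qx lq cq; rewrite leNgt; apply/negP => x1.
have q0 : q != 0.
  by rewrite -lead_coef_eq0 -nonarch_eq0 lq oner_eq0.
move: qx; rewrite /root horner_coef (polySpred q0) big_ord_recr /=.
set n := (size q).-1; rewrite -/n addr_eq0 => /eqP/(congr1 v).
have -> : q`_n = lead_coef q by rewrite lead_coefE.
rewrite nonarchN nonarchM lq mul1r nonarchX => sumE.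
have : v (\sum_(i < n) q`_i * x ^+ i) < v x ^+ n.
  case: n {sumE} => [|n]; first by rewrite big_ord0 nonarch0 expr0.
  (* Here [n] is one less than the degree: every lower term is at most |x|^n, and |x|^n <
     |x|^(n+1). *)
  apply: (@le_lt_trans _ _ (v x ^+ n)); last by rewrite ltr_eXn2l.
  apply: nonarch_sum => [|i _]; first by rewrite exprn_ge0 ?nonarch_ge0.
  rewrite nonarchM nonarchX -[leRHS]mul1r.
  apply: ler_pM; rewrite ?exprn_ge0 ?nonarch_ge0 ?cq //.
  by rewrite ler_weXn2l ?(ltW x1) // -ltnS.
by rewrite sumE ltxx.
Qed.

End Nonarchimedean.

(** * The p-adic absolute values on Q and the product formula *)

Section PadicAbs.
Variable R : realType.

Lemma padic_abs_int p (z : int) : z != 0 ->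
  padic_abs R p z%:~R = (p%:R ^+ logn p `|z|%N)^-1.
Proof.
move=> z0; rewrite /padic_abs intr_eq0 (negPf z0) numq_int denq_int.
by rewrite logn1 expr0 mul1r.
Qed.

Lemma padic_abs_int_le1 p (z : int) : prime p -> padic_abs R p z%:~R <= 1.
Proof.
move=> pp; have [->|z0] := eqVneq z 0; first by rewrite /padic_abs mulr0z eqxx.
have p1 : (1 : R) <= p%:R by rewrite ler1n prime_gt0.
by rewrite padic_abs_int // invf_le1 ?exprn_gt0 ?exprn_ege1 // (lt_le_trans
  ltr01).
Qed.

Lemma padic_abs_unit p (z : int) : z != 0 -> ~~ (p %| `|z|)%N ->
  padic_abs R p z%:~R = 1.
Proof.
move=> z0 pz; rewrite padic_abs_int // (_ : logn p `|z| = 0%N) ?expr0 ?invr1 //.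
have [pp|npp] := boolP (prime p); last by rewrite lognE (negPf npp).
by rewrite lognE (negPf pz) !andbF.
Qed.

(** Further entries of [l] contribute a factor 1: [logn] vanishes at nonprimes and at primes not
    dividing [n]. *)
Lemma prod_prime_powers (l : seq nat) n : (0 < n)%N -> uniq l ->
  {subset primes n <= l} -> (\prod_(p <- l) p ^ logn p n)%N = n.
Proof.
move=> n0 ul nl; rewrite [RHS]prod_prime_decomp // prime_decompE big_map /=.
rewrite (bigID (mem (primes n))) /= [X in (_ * X)%N]big1 ?muln1; last first.
  move=> p pn; have [pp|npp] := boolP (prime p); last first.
    by rewrite lognE (negPf npp).
  move: pn; rewrite mem_primes pp n0 /= => pn.
  by rewrite lognE (negPf pn) !andbF.
rewrite -big_filter; apply: perm_big; apply: uniq_perm.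
- by rewrite filter_uniq.
- exact: primes_uniq.
- move=> p; rewrite mem_filter andb_idr //; exact: nl.
Qed.

(** Unique factorisation of the numerator and the denominator, with one list [l] that covers the
    primes of both. *)
Lemma padic_product_formula (q : rat) (l : seq nat) : q != 0 -> uniq l ->
  {subset primes `|numq q| <= l} -> {subset primes `|denq q| <= l} ->
  \prod_(p <- l) padic_abs R p q = `|ratr q|^-1.
Proof.
move=> q0 ul nl dl.
under eq_bigr => p _ do rewrite /padic_abs (negPf q0) -!natrX.
rewrite big_split /= prodfV -!natr_prod !prod_prime_powers ?absz_gt0
  ?denq_eq0 ?numq_eq0 //.
rewrite /ratr normrM normfV invfM invrK mulrC !natr_absz !intr_norm.
by rewrite mulrC.
Qed.

End PadicAbs.

(** The map is the composite through the tower. Splitting comes from the algebraically closed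
    [Qpbar], and each stage preserves the absolute value. *)
Lemma padic_tower_rat (R : realType) p (T : padic_tower R p) :
  exists f : {rmorphism rat -> Cp T},
    rat_splits f /\ forall q, Cp_abs (f q) = padic_abs R p q.
Proof.
exists (Cp_of_Qpbar T \o (Qpbar_of_Qp T \o Qp_of_rat T)); split.
  apply: (rat_splits_comp (Cp_of_Qpbar T)).
  exact: (@closed_field_rat_splits _ (Qpbar_of_Qp T \o Qp_of_rat T)).
move=> q /=.
have [-> _ _] := Cp_completion T; rewrite Qpbar_abs_ext.
by have [-> _ _] := Qp_completion T.
Qed.

(** * Local heights: lower bounds and vanishing at almost all primes *)

Lemma ln_prod (R : realType) (I : eqType) (r : seq I) (F : I -> R) :
  (forall i, i \in r -> 0 < F i) ->
  ln (\prod_(i <- r) F i) = \sum_(i <- r) ln (F i).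
Proof.
elim: r => [|i r IH] F0; first by rewrite !big_nil ln1.
have Fr j : j \in r -> 0 < F j by move=> jr; rewrite F0 // in_cons jr orbT.
rewrite !big_cons lnM ?IH // posrE ?F0 ?mem_head // big_seq prodr_gt0 //.
Qed.

Lemma embeddings_mem (K L : fieldType) (ss : seq (K -> L)) s :
  @embeddings K L = [set` ss] -> s \in ss ->
  exists g : {rmorphism K -> L}, s = g.
Proof. by move=> ssE sss; have : @embeddings K L s by rewrite ssE. Qed.

Lemma local_height_seq (R : realType) (K L : fieldType) (v : L -> R)
    (ss : seq (K -> L)) n (y : 'rV[K]_n) :
  uniq ss -> @embeddings K L = [set` ss] ->
  local_height v y = \sum_(s <- ss) log_max v (map_mx s y).
Proof. by move=> uss ssE; rewrite /local_height ssE (fsbig_seq _ _ uss). Qed.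

(** The maximum over all coordinates dominates the one over two of them; y_j being nonzero makes the
    latter positive, where [ln] is monotone. The hypotheses on [v] hold both for the complex modulus
    and for [Cp_abs]. *)
Lemma local_height_ge_pair (R : realType) (K L : fieldType) (v : L -> R)
    (ss : seq (K -> L)) n (y : 'rV[K]_n) (i j : 'I_n) :
  (forall x, 0 <= v x) -> (forall x, v x = 0 -> x = 0) ->
  uniq ss -> @embeddings K L = [set` ss] -> y 0 j != 0 ->
  ln (\prod_(s <- ss) Num.max (v (s (y 0 j))) (v (s (y 0 i))))
    <= local_height v y.
Proof.
move=> v0 vE uss ssE yj; rewrite (local_height_seq v y uss ssE).
have P s : s \in ss -> 0 < Num.max (v (s (y 0 j))) (v (s (y 0 i))).
  move=> /(embeddings_mem ssE)[g ->]; rewrite lt_max lt_neqAle v0 andbT.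
  apply/orP; left; apply: contraNneq yj => /esym/vE/eqP.
  by rewrite fmorph_eq0.
rewrite ln_prod // big_seq [leRHS]big_seq; apply: ler_sum => s sss.
have le_m k : v (s (y 0 k)) <= \big[Num.max/0]_(i0 < n) v (map_mx s y 0 i0).
  apply: le_trans (le_bigmax _ (fun i0 => v (map_mx s y 0 i0)) k).
  by rewrite mxE.
have le_mm : Num.max (v (s (y 0 j))) (v (s (y 0 i)))
    <= \big[Num.max/0]_(i0 < n) v (map_mx s y 0 i0).
  by rewrite ge_max !le_m.
by rewrite /log_max ler_ln ?posrE ?P // (lt_le_trans (P _ sss)).
Qed.

Lemma primitive_coef_ndvd (G : {poly int}) p : prime p -> zcontents G = 1 ->
  exists i, ~~ (p %| `|(G`_i)%R|)%N.
Proof.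
move=> pp G1; apply: contrapT => H.
have : (p%:Z %| zcontents G)%Z.
  rewrite dvdz_contents; apply/polyOverP => i; apply: contrapT => pi.
  by apply: H; exists i; apply/negP.
by rewrite G1 dvdzE /= dvdn1; move: pp; case: p {H} => [|[|p]].
Qed.

(* By Gauss's lemma |c|_p is the Gauss norm of F, whose factors over C_p have
   Gauss norm max(|s y_j|, |s y_i|). *)
Lemma local_height_ge_content (R : realType) p (T : padic_tower R p)
    (K : fieldExtType rat) n (y : 'rV[K]_n) (i j : 'I_n) F c G :
  prime p -> y 0 j != 0 -> embeddings_norm_form (y 0 j) (y 0 i) F ->
  c != 0 -> zcontents G = 1 -> F = c *: map_poly (intr : int -> rat) G ->
  ln (padic_abs R p c) <= local_height (@Cp_abs _ _ T) y.
Proof.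
move=> pp yj FP c0 G1 FE.
have vna := Cp_abs_nonarch T; have [f [fs fE]] := padic_tower_rat T.
have [ss [uss ssE _]] := embeddings_enum K fs.
apply: le_trans (local_height_ge_pair (ss := ss) i _ _ uss ssE yj); last 2
  first.
- exact: nonarch_ge0 vna.
- by move=> x /eqP; rewrite (nonarch_eq0 vna) => /eqP.
have c_gt0 : 0 < padic_abs R p c.
  by rewrite -fE lt_neqAle (nonarch_ge0 vna) eq_sym (nonarch_eq0 vna)
    fmorph_eq0 c0.
have [k kG] := primitive_coef_ndvd pp G1.
have le_P : padic_abs R p c
    <= \prod_(s <- ss) Num.max (Cp_abs (s (y 0 j))) (Cp_abs (s (y 0 i))).
  apply: le_trans (nonarch_coef_prod_linear vna ss _ _ k).
  rewrite -(FP _ f ss uss ssE fs) FE coef_map coefZ coef_map /= rmorphM.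
  rewrite (nonarchM vna) !fE padic_abs_unit ?mulr1 //.
  by apply: contraNneq kG => ->; rewrite dvdn0.
by rewrite ler_ln ?posrE // (lt_le_trans c_gt0).
Qed.

(** [N] is the leading coefficient of an integral polynomial vanishing at [z]. At a prime not
    dividing it this coefficient is a unit, so [z] is p-integral under every embedding. *)
Lemma embedding_le1_cofinite (K : fieldExtType rat) (z : K) :
  exists N, (0 < N)%N /\ forall (R : realType) p (T : padic_tower R p)
    (s : {rmorphism K -> Cp T}), prime p -> ~~ (p %| N)%N -> Cp_abs (s z) <= 1.
Proof.
have /polyOver1P[m mE] := minPolyOver 1 z.
have m0 : m != 0.
  by rewrite -(map_poly_eq0 (in_alg K)) -mE monic_neq0 // monic_minPoly.
have mz : root (map_poly (in_alg K) m) z by rewrite -mE root_minPoly.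
have [Q [a a0 QE]] := rat_poly_scale m.
have Q0 : Q != 0.
  by apply: contraNneq m0 => Q0; rewrite QE Q0 map_poly0 scaler0.
have lQ : lead_coef Q != 0 by rewrite lead_coef_eq0.
exists `|lead_coef Q|%N; split; first by rewrite absz_gt0.
move=> R p T s pp pN; have [f [fs fE]] := padic_tower_rat T.
pose q := map_poly f (map_poly (intr : int -> rat) Q).
have lq : lead_coef q = f (lead_coef Q)%:~R.
  by rewrite lead_coef_map lead_coef_map_inj //; apply: intr_inj.
apply: (nonarch_root_le1 (Cp_abs_nonarch T) (q := q)).
- rewrite /q (root_map_rat s f); move: mz; rewrite QE map_polyZ rootZ //.
  by rewrite fmorph_eq0 invr_eq0 intr_eq0.
- by rewrite lq fE padic_abs_unit.
- by move=> i; rewrite !coef_map /= fE padic_abs_int_le1.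
Qed.

Lemma local_height_cofinite (R : realType) (K : fieldExtType rat) n
    (y : 'rV[K]_n) (j : 'I_n) : y 0 j != 0 ->
  exists2 N, (0 < N)%N & forall p (T : padic_tower R p), prime p ->
    ~~ (p %| N)%N -> local_height (@Cp_abs _ _ T) y = 0.
Proof.
move=> yj.
have [B BP] := choice (@embedding_le1_cofinite K).
(* Away from these primes all y_i and 1/y_j have absolute value at most 1, so the maximum over the
   coordinates is exactly 1. *)
exists (B ((y 0 j)^-1)%R * \prod_(i < n) B (y 0 i)%R)%N.
  by rewrite muln_gt0; have [-> _] := BP (y 0 j)^-1; rewrite prodn_gt0 // =>
    i; case: (BP (y 0 i)).
move=> p T pp; rewrite Euclid_dvdM // negb_or => /andP[pj pi].
have vna := Cp_abs_nonarch T; have [f [fs fE]] := padic_tower_rat T.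
have [ss [uss ssE _]] := embeddings_enum K fs.
rewrite (local_height_seq _ y uss ssE) big_seq big1 // => s.
move=> /(embeddings_mem ssE)[g ->].
rewrite /log_max (_ : \big[_/_]_(_ < _) _ = 1) ?ln1 //.
apply/eqP; rewrite eq_le; apply/andP; split.
  apply: bigmax_le => // i _; rewrite mxE.
  have [_ H] := BP (y 0 i); apply: H => //.
  by apply: contraNN pi => pi; rewrite (bigD1 i) //= dvdn_mulr.
apply: le_trans (le_bigmax _ _ j); rewrite mxE.
have [_ H] := BP (y 0 j)^-1; have := H R p T g pp pj.
rewrite fmorphV (nonarchV vna) invf_le1 // lt_neqAle (nonarch_ge0 vna) eq_sym.
by rewrite (nonarch_eq0 vna) fmorph_eq0 yj.
Qed.

(** The local inequalities are summed over finitely many primes, and the product formula turns the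
    sum of the ln |c|_p into - ln |c|. *)
Lemma nonarch_height_ge (R : realType)
    (C : forall p : prime_number, padic_tower R (val p))
    (K : fieldExtType rat) n (y : 'rV[K]_n) (j : 'I_n) (c : rat) :
  y 0 j != 0 -> c != 0 ->
  (forall p, ln (padic_abs R (val p) c) <= local_height (@Cp_abs _ _ (C p))
    y) ->
  - ln `|ratr c| <= \sum_(p \in [set: prime_number])
    local_height (@Cp_abs _ _ (C p)) y.
Proof.
move=> yj c0 cy; have [N N0 NP] := local_height_cofinite R yj.
(* The primes dividing [M] include those with nonzero local height and those dividing the numerator
   or the denominator of [c]. *)
pose M := (N * (`|numq c| * `|denq c|))%N.
have cd0 : (0 < `|numq c| * `|denq c|)%N.
  by rewrite muln_gt0 !absz_gt0 numq_eq0 c0 denq_eq0.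
have M0 : (0 < M)%N by rewrite muln_gt0 N0.
pose l : seq prime_number :=
  pmap (insub : nat -> option {p : nat | prime p}) (primes M).
have ul : uniq l by apply: pmap_sub_uniq; apply: primes_uniq.
have lE : [seq val p | p <- l] = primes M.
  rewrite (pmap_filter (insubK _)); apply/all_filterP/allP => p.
  by rewrite mem_primes => /andP[pp _]; rewrite insubT.
have lP (p : prime_number) : (val p %| M)%N -> p \in l.
  move=> pM; rewrite -(mem_map val_inj) lE mem_primes pM M0.
  by rewrite (valP p).
(* A sum with infinite support would be 0 by default; here the local heights vanish off the finite
   list [l]. *)
rewrite -(fsbig_widen [set` l]) //=; last first.
  move=> p [_ /= pl]; apply: NP; first exact: (valP p).
  by apply/negP => pN; apply: pl; apply: lP; rewrite dvdn_mulr.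
rewrite -fsbig_seq //; apply: le_trans (ler_sum _ (fun p _ => cy p)).
rewrite -lnV ?posrE ?normr_gt0 ?fmorph_eq0 //.
rewrite -(padic_product_formula R c0 (primes_uniq M)); first last.
- move=> p; rewrite !mem_primes M0 => /and3P[-> _ pd] /=.
  by rewrite !dvdn_mull.
- move=> p; rewrite !mem_primes M0 => /and3P[-> _ pd] /=.
  by rewrite dvdn_mull // dvdn_mulr.
rewrite -lE big_map ln_prod // => p _.
rewrite /padic_abs (negPf c0) divr_gt0 // exprn_gt0 // ltr0n prime_gt0 //;
  exact: (valP p).
Qed.

(** * The complex modulus, Mahler measure and the archimedean local height *)

Section ComplexNorm.
Variable R : realType.
Local Notation N := (@ComplexField.Normc.normc R : R[i] -> R).

Lemma normcE (x : R[i]) : ((N x)%:C)%C = `|x|.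
Proof. by case: x. Qed.

Lemma normc_ge0 x : 0 <= N x.
Proof. by case: x => a b; apply: sqrtr_ge0. Qed.

Lemma normc_eq0 x : (N x == 0) = (x == 0).
Proof.
apply/eqP/eqP => [/ComplexField.Normc.eq0_normc//|->].
exact: ComplexField.Normc.normc0.
Qed.

Lemma normc_0 : N 0 = 0.
Proof. by apply/eqP; rewrite normc_eq0. Qed.

Lemma normc_1 : N 1 = 1.
Proof. by apply: (@complexI R); rewrite normcE normr1. Qed.

Lemma normc_prod (I : Type) (r : seq I) (F : I -> R[i]) :
  N (\prod_(i <- r) F i) = \prod_(i <- r) N (F i).
Proof.
by apply: (big_morph N); [exact: ComplexField.Normc.normcM|exact: normc_1].
Qed.

Lemma normc_rat (f : {rmorphism rat -> R[i]}) q : N (f q) = `|ratr q|.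
Proof.
apply: (@complexI R); rewrite normcE.
have -> : f q = ((ratr q)%:C)%C.
  exact: (eq_rmorphism_rat f (real_complex R \o ratr)).
by rewrite normc_def /= expr0n /= addr0 sqrtr_sqr.
Qed.

Lemma normcB x y : N (x - y) <= N x + N y.
Proof.
have := ler_normB x y; rewrite -!normcE -rmorphD /=.
by rewrite lecR.
Qed.

Definition mahler (a : R[i]) (rs : seq R[i]) : R :=
  N a * \prod_(r <- rs) Num.max 1 (N r).

(** Multiplication by X - r adds to each shifted coefficient r times another one, so the largest
    modulus grows by a factor at most 1 + |r| <= 2 max(1, |r|). *)
Lemma coef_le_mahler a (rs : seq R[i]) i :
  N (a *: \prod_(r <- rs) ('X - r%:P))`_i <= 2 ^+ size rs * mahler a rs.
Proof.
rewrite coefZ ComplexField.Normc.normcM mulrCA; apply: ler_wpM2l.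
  exact: normc_ge0.
elim: rs i => [|r rs IH] i.
  rewrite !big_nil coef1 expr0 mul1r.
  by case: eqP => _; rewrite ?mulr1n ?mulr0n ?normc_1 ?normc_0.
have P0 : 0 <= 2 ^+ size rs * \prod_(j <- rs) Num.max 1 (N j).
  by rewrite mulr_ge0 ?exprn_ge0 // prodr_ge0 // => j _; rewrite le_max ler01.
rewrite !big_cons mulrBl coefB coefXM coefCM.
apply: le_trans (normcB _ _) _; rewrite ComplexField.Normc.normcM /= exprS.
set P := 2 ^+ size rs * \prod_(j <- rs) Num.max 1 (N j) in P0 IH.
have -> : 2 * 2 ^+ size rs * (Num.max 1 (N r) * \prod_(j <- rs) Num.max 1 (N j))
    = Num.max 1 (N r) * P + Num.max 1 (N r) * P.
  by rewrite /P; ring.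
apply: lerD.
  apply: (@le_trans _ _ P); last by rewrite ler_peMl // le_max lexx.
  by case: (i == 0)%N; rewrite ?normc_0 ?IH.
apply: ler_pM; rewrite ?normc_ge0 ?le_max ?lexx ?orbT //.
Qed.

Lemma prod_XsubC_exp_perm (L : fieldType) (s rs : seq L) n :
  \prod_(r <- s) ('X - r%:P) = (\prod_(r <- rs) ('X - r%:P)) ^+ n ->
  perm_eq s (flatten (nseq n rs)).
Proof.
move=> E; apply: prod_XsubC_eq; rewrite E big_flatten big_nseq.
by rewrite iter_mulr_1.
Qed.

End ComplexNorm.

(** Taking |s(y_j)| out of each factor max(|s(y_j)|, |s(y_i)|) leaves max(1, |s(y_i/y_j)|). The
    s(y_j) multiply to the leading coefficient of [F], and the s(y_i/y_j) run [e] times through the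
    roots of [m]; here [e] is a multiplicity, not a degree. *)
Lemma arch_local_height_ge (R : realType) (K : fieldExtType rat) n
    (y : 'rV[K]_n) (i j : 'I_n) F (m : {poly rat}) e :
  y 0 j != 0 -> embeddings_norm_form (y 0 j) (y 0 i) F ->
  lead_coef F != 0 -> m \is monic -> F = lead_coef F *: m ^+ e ->
  forall (f : {rmorphism rat -> R[i]}) (rs : seq R[i]),
  map_poly f m = \prod_(r <- rs) ('X - r%:P) ->
  ln `|ratr (lead_coef F)| + e%:R * ln (\prod_(r <- rs)
      Num.max 1 (ComplexField.Normc.normc r))
    <= local_height (@ComplexField.Normc.normc R : R[i] -> R) y.
Proof.
move=> yj FP F0 mm FE f rs mE.
have fs : rat_splits f by apply: closed_field_rat_splits.
have [ss [uss ssE _]] := embeddings_enum K fs.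
set N := (@ComplexField.Normc.normc R : R[i] -> R).
apply: le_trans (local_height_ge_pair (ss := ss) i _ _ uss ssE yj); last 2
  first.
- exact: normc_ge0.
- by move=> x /eqP; rewrite normc_eq0 => /eqP.
have FfE : map_poly f F = (\prod_(s <- ss) s (y 0 j)) *:
    \prod_(s <- ss) ('X - (s (y 0 i / y 0 j))%:P).
  rewrite (FP _ f ss uss ssE fs) -mul_polyC rmorph_prod -big_split /=.
  rewrite big_seq [in RHS]big_seq; apply: eq_bigr => s /(embeddings_mem
    ssE)[g ->].
  by rewrite -mul_polyC mulrBr -polyCM -rmorphM (mulrC (y 0 j)) divfK.
have lF : f (lead_coef F) = \prod_(s <- ss) s (y 0 j).
  rewrite -lead_coef_map FfE lead_coefZ (monicP _) ?mulr1 //.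
  exact: monic_prod_XsubC.
have prE : \prod_(r <- [seq s (y 0 i / y 0 j) | s <- ss]) ('X - r%:P)
    = (\prod_(r <- rs) ('X - r%:P)) ^+ e.
  have lF0 : f (lead_coef F) != 0 by rewrite fmorph_eq0.
  apply: (scalerI lF0); rewrite big_map [in LHS]lF -FfE {1}FE map_polyZ
    rmorphXn /=.
  by rewrite mE.
have -> : \prod_(s <- ss) Num.max (N (s (y 0 j))) (N (s (y 0 i)))
   = `|ratr (lead_coef F)| * (\prod_(r <- rs) Num.max 1 (N r)) ^+ e.
  rewrite -(normc_rat f) lF normc_prod.
  have <- : \prod_(t <- nseq e rs) \prod_(r <- t) Num.max 1 (N r)
      = (\prod_(r <- rs) Num.max 1 (N r)) ^+ e.
    by rewrite big_nseq iter_mulr_1.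
  rewrite -big_flatten -(perm_big _ (prod_XsubC_exp_perm prE)) big_map
    -big_split /=.
  rewrite big_seq [in RHS]big_seq; apply: eq_bigr => s /(embeddings_mem
    ssE)[g ->].
  rewrite maxr_pMr ?normc_ge0 // mulr1 -ComplexField.Normc.normcM -rmorphM /=.
  by rewrite mulrC divfK.
have P0 : 0 < \prod_(r <- rs) Num.max 1 (N r).
  by apply: prodr_gt0 => r _; rewrite lt_max ltr01.
rewrite lnM ?posrE ?normr_gt0 ?fmorph_eq0 ?exprn_gt0 //.
by rewrite lnXn // mulr_natl.
Qed.

(** * Integral minimal polynomials with coefficients bounded by the height *)

Lemma primitive_int_poly (m : {poly rat}) : m != 0 ->
  exists (a : rat) (Q : {poly int}),
    [/\ a != 0, zcontents Q = 1 & m = a *: map_poly (intr : int -> rat) Q].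
Proof.
move=> m0; have [q [b b0 mE]] := rat_poly_scale m.
have q0 : q != 0 by apply: contraNneq m0 => q0; rewrite mE q0 map_poly0 scaler0.
exists (b%:~R^-1 * (zcontents q)%:~R), (zprimitive q); split.
- by rewrite mulf_neq0 ?invr_eq0 ?intr_eq0 // zcontents_eq0.
- by rewrite zcontents_primitive q0.
- by rewrite mE {1}[q]zpolyEprim map_polyZ scalerA.
Qed.

Lemma zcontents_exp (Q : {poly int}) n : zcontents Q = 1 -> zcontents (Q ^+
  n) = 1.
Proof.
move=> Q1; elim: n => [|n IH]; last by rewrite exprS zcontentsM Q1 IH.
by rewrite expr0 zcontents_monic ?monic1.
Qed.

(** The witness is the primitive integral multiple of [m]. Its Mahler measure is at most exp(e B),
    and its coefficients are at most 2^e times that; the degree of K drops out of the bound. *)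
Lemma height_coef_bound (R : realType)
    (C : forall p : prime_number, padic_tower R (val p))
    (K : fieldExtType rat) (iota : {rmorphism K -> algC}) n (y : 'rV[K]_n)
    (i j : 'I_n) (m : {poly rat}) (B : R) (e := (size m).-1) :
  y 0 j != 0 -> min_poly_rat (iota (y 0 i / y 0 j)) m ->
  height_coords C y <= B ->
  exists Q : {poly int},
    [/\ Q != 0, size Q = size m,
        root (map_poly (intr : int -> algC) Q) (iota (y 0 i / y 0 j))
      & forall k, `|Q`_k|%:~R <= 2 ^+ e * expR (e%:R * B)].
Proof.
move=> yj mP yB; have [mm mE] := mP.
have [F FP] := embeddings_norm_formP (y 0 j) (y 0 i).
have [t [F0 FE mt]] := norm_form_power yj mP FP.
have [a [Q [a0 Q1 mQ]]] := primitive_int_poly (monic_neq0 mm).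
have Q0 : Q != 0 by rewrite -zcontents_eq0 Q1.
have sQ : size Q = size m.
  by rewrite mQ size_scale // size_map_inj_poly ?mulr0z // => u v /intr_inj.
have alQ : a * (lead_coef Q)%:~R = 1.
  transitivity (lead_coef m); last exact/monicP.
  by rewrite mQ lead_coefZ lead_coef_map_inj ?mulr0z // => u v /intr_inj.
have aV : a^-1 = (lead_coef Q)%:~R by apply: (mulfI a0); rewrite divff // alQ.
exists Q; split => //.
  have : root (map_poly (ratr : rat -> algC) m) (iota (y 0 i / y 0 j)) by
    rewrite mE.
  rewrite mQ map_polyZ rootZ ?fmorph_eq0 // -map_poly_comp.
  by rewrite (eq_map_poly (fun z => ratr_int _ z)).
pose f : {rmorphism rat -> R[i]} := real_complex R \o ratr.
have [rs] := closed_field_rat_splits f m.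
rewrite (monicP mm) rmorph1 scale1r => rsE.
have ers : size rs = e.
  by apply: succn_inj; rewrite -(size_prod_XsubC rs id) -rsE size_map_poly /e
    prednK // size_poly_gt0 monic_neq0.
have archP := arch_local_height_ge yj FP F0 mm FE rsE.
(* As m = a Q, the norm form is c Q^t, and Q^t is primitive by Gauss's lemma. *)
pose c := lead_coef F * a ^+ t.
have c0 : c != 0 by rewrite mulf_neq0 ?expf_neq0.
have FQ : F = c *: map_poly (intr : int -> rat) (Q ^+ t).
  by rewrite FE mQ exprZn scalerA rmorphXn.
have nonarchP : - ln `|ratr c| <= \sum_(p \in [set: prime_number])
    local_height (@Cp_abs _ _ (C p)) y.
  apply: (nonarch_height_ge yj c0) => p.
  exact: (local_height_ge_content (C p) (valP p) yj FP c0 (zcontents_exp t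
    Q1) FQ).
have D0 : (0 < \dim {:K})%N by apply: adim_gt0.
have t0 : (0 < t)%N by move: D0; rewrite -mt muln_gt0 => /andP[].
pose M := mahler (f (lead_coef Q)%:~R) rs.
have PM : 0 < \prod_(r <- rs) Num.max 1 (ComplexField.Normc.normc r).
  by apply: prodr_gt0 => r _; rewrite lt_max ltr01.
have lQ0 : (lead_coef Q)%:~R != 0 :> rat by rewrite intr_eq0 lead_coef_eq0.
have M0 : 0 < M by rewrite /M /mahler normc_rat mulr_gt0 // normr_gt0
  fmorph_eq0.
(* After multiplication by t the right side is [K:Q] B, as e t = [K:Q]. The terms ln |lead_coef F|
   cancel between the bound at infinity and the one at the primes, and - ln |a| is the logarithm of
   the leading coefficient of [Q]. *)
have lnM_le : ln M <= e%:R * B.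
  have t0R : (0 : R) < t%:R by rewrite ltr0n.
  rewrite -(ler_pM2l t0R).
  have -> : t%:R * (e%:R * B) = (\dim {:K})%:R * B.
    by rewrite -mt natrM mulrA (mulrC t%:R).
  have D0R : (0 : R) < (\dim {:K})%:R by rewrite ltr0n.
  move: yB; rewrite /height_coords mulrC ler_pdivrMr // (mulrC B).
  apply: le_trans; apply: le_trans (lerD archP nonarchP).
  have rc0 (q : rat) : q != 0 -> 0 < `|ratr q : R| by move=> q0; rewrite
    normr_gt0 fmorph_eq0.
  have -> : ln M = - ln `|ratr a| + ln (\prod_(r <- rs) Num.max 1
    (ComplexField.Normc.normc r)).
    rewrite /M /mahler lnM ?posrE // normc_rat ?rc0 //; congr (_ + _).
    by rewrite -lnV ?posrE ?rc0 // -normfV -fmorphV aV.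
  have -> : `|ratr c : R| = `|ratr (lead_coef F)| * `|ratr a| ^+ t.
    by rewrite /c rmorphM rmorphXn /= normrM normrX.
  rewrite [in leRHS]lnM ?posrE ?exprn_gt0 ?rc0 //.
  by rewrite lnXn ?rc0 // -mulr_natl; lra.
move=> k; apply: (@le_trans _ _ (2 ^+ size rs * M)); last first.
  by rewrite ers ler_pM2l ?exprn_gt0 // -[leLHS]lnK ?posrE // ler_expR.
have -> : (`|Q`_k|%:~R : R) = ComplexField.Normc.normc (f (Q`_k)%:~R).
  by rewrite normc_rat ratr_int intr_norm.
(* The image of [Q] is its leading coefficient times the product over [rs], because a times that
   coefficient is 1. *)
apply: le_trans (coef_le_mahler _ rs k); rewrite -rsE mQ map_polyZ scalerA.
by rewrite -rmorphM /= (mulrC _ a) alQ rmorph1 scale1r !coef_map.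
Qed.

(** * Finiteness of bounded roots and of the set of points *)

Lemma finite_bounded_roots d N :
  finite_set [set a : algC | exists Q : {poly int},
    [/\ Q != 0, (size Q <= d.+1)%N, root (map_poly (intr : int -> algC) Q) a
      & forall k, (`|(Q`_k)%R| <= N)%N]].
Proof.
(* Coefficients in [-N, N] are shifted by N to ordinals, so that a finite type indexes the
   polynomials. *)
pose p (g : {ffun 'I_d.+1 -> 'I_(N + N).+1}) : {poly int} :=
  \poly_(k < d.+1) ((g (inord k))%:Z - N%:Z).
pose Z g := [set a : algC | p g != 0 /\ root (map_poly (intr : int -> algC)
  (p g)) a].
apply: (@sub_finite_set _ _ (\bigcup_(g in [set: {ffun 'I_d.+1 -> 'I_(N +
  N).+1}]) Z g)).
  move=> a [Q [Q0 sQ Qa QN]].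
  pose g : {ffun 'I_d.+1 -> 'I_(N + N).+1} :=
    [ffun k : 'I_d.+1 => inord `|(Q`_k + N%:Z)%R|%N].
  have pg : p g = Q.
    apply/polyP => k; rewrite coef_poly; case: ltnP => kd; last first.
      by rewrite nth_default // (leq_trans sQ).
    have qN := QN k; rewrite ffunE (inordK kd).
    by rewrite inordK; lia.
  by exists g => //; rewrite /Z /= pg.
apply: bigcup_finite; first exact: finite_finset.
move=> g _; have [rs rsE] := closed_field_poly_normal (map_poly (intr : int
  -> algC) (p g)).
apply: (@sub_finite_set _ _ [set` rs]); last exact: finite_seq.
move=> a [pg0] /=; rewrite rsE rootZ ?root_prod_XsubC //.
rewrite lead_coef_eq0; apply: contraNneq pg0 => /polyP H.
apply/eqP/polyP => k; have /eqP := H k.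
by rewrite coef_map coef0 coefE /= intr_eq0 => /eqP.
Qed.

Lemma finite_row_vectors (T : choiceType) (S : set T) n : finite_set S ->
  finite_set [set v : 'rV[T]_n | forall i, S (v 0 i)].
Proof.
move=> /finite_seqP[s ->].
apply: (@sub_finite_set _ _ ((fun g : {ffun 'I_n -> seq_sub s} =>
  \row_i val (g i)) @` setT)); last by apply: finite_image; exact:
    finite_finset.
move=> v vs; exists [ffun i => SeqSub (vs i)] => //.
by apply/rowP => i; rewrite mxE ffunE.
Qed.

(** The degree of [m] depends on the algebraic number alone, so any field containing that number
    bounds it, whichever field computes the height. *)
Lemma min_poly_rat_size_le (K : fieldExtType rat) (iota : {rmorphism K -> algC})
    (z : K) m : min_poly_rat (iota z) m -> (size m <= (\dim {:K}).+1)%N.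
Proof.
move=> [_ mE]; have /polyOver1P[q qE] := minPolyOver 1 z.
have q0 : q != 0.
  by rewrite -(map_poly_eq0 (in_alg K)) -qE monic_neq0 // monic_minPoly.
apply: (@leq_trans (size q)).
  by apply: dvdp_leq; rewrite // -mE root_map_rat -qE root_minPoly.
rewrite -(size_map_poly (in_alg K)) -qE size_minPoly adjoin_degreeE dimv1 divn1.
by rewrite ltnS dimvS // subvf.
Qed.

Theorem mainTheorem2 (R : realType)
    (C : forall p : prime_number, padic_tower R (val p))
    (d k : nat) (hd : (1 <= d)%N) (hk : (1 <= k)%N) (B : R) :
  finite_set [set x : proj_space k |
    defined_over_degree_le d x /\ weil_height C x <= B].
Proof.
(* A bound for 2^e exp(e B) uniform in e <= d; the maximum with 0 makes e B <= d max(0, B) hold for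
   negative B too. *)
pose M : R := 2 ^+ d * expR (d%:R * Num.max 0 B).
have M0 : 0 <= M by rewrite mulr_ge0 ?exprn_ge0 ?expR_ge0.
have finV := finite_row_vectors k.+1 (finite_bounded_roots d (Num.bound M)).
set V := [set v : 'rV[algC]_k.+1 | _] in finV.
(* The points are covered by the images of nonzero vectors whose coordinates are roots of bounded
   integral polynomials. *)
apply: (@sub_finite_set _ _
  ((fun w : nonzero_vector k => \pi_(proj_space k)%qT w) @`
     ((fun w : nonzero_vector k => val w) @^-1` V))); last first.
  apply: finite_image; apply: finite_preimage finV.
  by move=> v w _ _; apply: val_inj.
move=> x [[K0 [iota0 [dimK0 [z [z0 xz]]]]] xB].
(* The field K behind the value of weil_height may have degree larger than d;
   only the minimal polynomials of the ratios are controlled by K0. *)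
have [K [iota [y [[y0 xy] yB]]]] :
    exists (K : fieldExtType rat) (iota : {rmorphism K -> algC}) (y :
      'rV[K]_k.+1),
    coords_in x iota y /\ weil_height C x = height_coords C y.
  (* Coordinates in [K0] show that the set is nonempty, so [xget] returns one of its elements and
     not the default 0. *)
  apply: (@xgetPex _ 0 [set r : R | exists (K : fieldExtType rat)
    (iota : {rmorphism K -> algC}) (y : 'rV[K]_k.+1),
    coords_in x iota y /\ r = height_coords C y]).
  by exists (height_coords C z), K0, iota0, z; split => //; exists z0.
have [c c0 zy] : exists2 c : algC, c != 0 & map_mx iota0 z = c *: map_mx iota y.
  have : \pi_(proj_space k)%qT (exist (fun v => v != 0) _ y0 : nonzero_vector k)
      = \pi_(proj_space k)%qT (exist (fun v => v != 0) _ z0 : nonzero_vector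
        k) by rewrite -xy.
  by move=> /eqmodP /asboolP.
have zyE i : iota0 (z 0 i) = c * iota (y 0 i).
  by have /rowP/(_ i) := zy; rewrite !mxE.
have /rV0Pn[j] := y0; rewrite mxE fmorph_eq0 => yj.
(* Representative of [x] with j-th coordinate 1, whose entries are the ratios to be bounded. *)
pose v : 'rV[algC]_k.+1 := \row_i iota (y 0 i / y 0 j).
have v0 : v != 0 by apply/rV0Pn; exists j; rewrite mxE divff // rmorph1
  oner_eq0.
exists (exist (fun v => v != 0) v v0) => /=; last first.
  rewrite xy; apply/eqmodP/asboolP; exists (iota (y 0 j)); rewrite
    ?fmorph_eq0 //.
  by apply/rowP => i; rewrite !mxE -rmorphM mulrC divfK.
move=> i; rewrite mxE.
have [m [_ mm mE]] := minCpolyP (iota (y 0 i / y 0 j)).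
have mP : min_poly_rat (iota (y 0 i / y 0 j)) m by [].
have sm : (size m <= d.+1)%N.
  apply: (@leq_trans (\dim {:K0}).+1); last by rewrite ltnS.
  (* The factor [c] cancels in the ratio, which therefore also lies in the image of [K0]. *)
  apply: (@min_poly_rat_size_le K0 iota0 (z 0 i / z 0 j)).
  rewrite fmorph_div !zyE -mulf_div divff // mul1r -fmorph_div.
  exact: mP.
have yB' : height_coords C y <= B by rewrite -yB.
have [Q [Q0 sQ Qa QB]] := height_coef_bound yj mP yB'.
exists Q; split => //; first by rewrite sQ.
move=> l; apply: ltnW; rewrite -(ltr_nat R).
apply: le_lt_trans (archi_boundP M0).
rewrite natr_absz; apply: le_trans (QB l) _.
have em : ((size m).-1 <= d)%N by case: (size m) sm.
apply: ler_pM; rewrite ?exprn_ge0 ?expR_ge0 //.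
  by rewrite ler_weXn2l // ler1n.
rewrite ler_expR; apply: (@le_trans _ _ ((size m).-1%:R * Num.max 0 B)).
  by rewrite ler_wpM2l // le_max lexx orbT.
by rewrite ler_wpM2r ?ler_nat // le_max lexx.
Qed.
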